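(* Let $k>1$ be a natural number and let $G$ be a $k$-regular bipartite graph of order $n$. Then $$\gamma_{t}(G) \le n\left(1- \frac{k!}{\prod_{i=0}^{k-1}\left(\frac{k}{k-1}+i\right)}\right).$$
   Context: All graphs are finite and simple (no loops, no multiple edges). The order of a graph is its number of vertices. A total dominating set of a graph $G$ is a set $S\subseteq V(G)$ such that every vertex of $G$ (including the vertices of $S$) is adjacent to at least one vertex of $S$. The total domination number $\gamma_t(G)$ is the minimum cardinality of a total dominating set of $G$. *)

(* Defs.v *)
From HB Require Import structures.
From mathcomp Require Import all_boot all_order all_algebra.

Set Implicit Arguments.
Unset Strict Implicit.
Unset Printing Implicit Defensive.

Section Graphs.
Variables (T : finType) (e : rel T).

Definition simple_graph : Prop := symmetric e /\ irreflexive e.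

Definition regular (k : nat) : Prop := forall x : T, #|[set y | e x y]| = k.

(* A bipartition is given by one of its (possibly empty) parts. *)
Definition bipartite : Prop :=
  exists A : {set T}, forall x y : T, e x y -> (x \in A) != (y \in A).

Definition total_dominating (S : {set T}) : bool :=
  [forall x : T, exists y in S, e x y].

(* The full vertex set is total dominating as soon as any set is, i.e. when
   there is no isolated vertex; otherwise this has the junk value #|T|. *)
Definition total_dom_number : nat :=
  #|[arg min_(S < [set: T] | total_dominating S) #|S|]|.

Lemma total_dominatingS (S S' : {set T}) :
  S \subset S' -> total_dominating S -> total_dominating S'.
Proof.
move=> /subsetP sSS' /forallP dS; apply/forallP=> x.
have /exists_inP[y yS exy] := dS x.
by apply/exists_inP; exists y; first exact: sSS'.
Qed.

Lemma total_dom_numberP (S0 : {set T}) : total_dominating S0 ->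
  (exists2 S, total_dominating S & #|S| = total_dom_number) /\
  (forall S, total_dominating S -> total_dom_number <= #|S|).
Proof.
move=> dS0; rewrite /total_dom_number.
case: arg_minnP => [|S dS minS]; first exact: total_dominatingS (subsetT S0) dS0.
by split=> //; exists S.
Qed.

End Graphs.

(* Main.v *)
(* A total dominating set is a transversal of the hypergraph of open
   neighbourhoods, which is k-uniform and k-regular, so its complement is a set
   containing no hyperedge. The Caro-Tuza argument produces a large such set:
   repeatedly delete a vertex of maximum degree D from a (m+1)-uniform
   hypergraph. With f(d) = \prod_(1 <= i <= d) (m i / (m i + 1)), the potential
   \sum_u f(deg u) does not decrease: the deleted vertex loses f(D), while the
   other vertices lose D m incidences in total, each of which gains at least
   f(D-1) - f(D) = f(D) / (D m) by convexity of f. Once no hyperedge is left,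
   the potential is the number of remaining vertices. *)
Require Import Defs.
From HB Require Import structures.
From mathcomp Require Import all_boot all_order all_algebra.
From mathcomp Require Import ring lra.
Import Order.TTheory GRing.Theory Num.Theory.
Local Open Scope ring_scope.

Section CaroTuzaWeight.
Variables (R : realFieldType) (m : nat).

Definition ct_weight (d : nat) : R :=
  \prod_(i < d) ((m * i.+1)%:R / (m * i.+1).+1%:R).

Lemma ct_weight_ge0 d : 0 <= ct_weight d.
Proof. by apply: prodr_ge0 => i _; rewrite divr_ge0 ?ler0n. Qed.

Lemma ct_weightS d :
  ct_weight d.+1 = ct_weight d * ((m * d.+1)%:R / (m * d.+1).+1%:R).
Proof. by rewrite /ct_weight big_ord_recr. Qed.

Lemma ct_weight_drop d :
  ct_weight d - ct_weight d.+1 = ct_weight d / (m * d.+1).+1%:R.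
Proof.
have nz : (m * d.+1).+1%:R != 0 :> R by rewrite pnatr_eq0.
by rewrite ct_weightS; move: nz; rewrite -natr1; move: (_%:R) => x nz; field.
Qed.

Lemma ct_weight_dropM d :
  (d.+1 * m)%:R * (ct_weight d - ct_weight d.+1) = ct_weight d.+1.
Proof. by rewrite ct_weight_drop ct_weightS mulnC mulrCA. Qed.

Lemma ct_weightS_le d : ct_weight d.+1 <= ct_weight d.
Proof.
by rewrite -subr_ge0 ct_weight_drop divr_ge0 ?ct_weight_ge0 ?ler0n.
Qed.

(** In the quotient of [ct_weight_drop], as [d] grows the numerator does not increase and the
    denominator does not decrease. *)
Lemma ct_weight_drop_le c d : (c <= d)%N ->
  ct_weight d - ct_weight d.+1 <= ct_weight c - ct_weight c.+1.
Proof.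
move=> /subnKC <-; elim: (d - c)%N => [|j]; first by rewrite addn0.
apply: le_trans; rewrite addnS !ct_weight_drop.
apply: ler_pM; rewrite ?ct_weight_ge0 ?invr_ge0 ?ler0n ?ct_weightS_le //.
by rewrite lef_pV2 ?posrE ?ltr0n // ler_nat ltnS leq_mul2l leqnSn orbT.
Qed.

(** The right side telescopes into [c] drops at indices at most [D], each at least the drop at
    [D]. *)
Lemma ct_weight_convex c d D : (c + d <= D.+1)%N ->
  c%:R * (ct_weight D - ct_weight D.+1) <= ct_weight d - ct_weight (c + d).
Proof.
elim: c => [|c IHc] cdD; first by rewrite mul0r add0n subrr.
have := IHc (ltnW cdD); have := @ct_weight_drop_le (c + d) D cdD.
by rewrite addSn -natr1 mulrDl mul1r; lra.
Qed.

End CaroTuzaWeight.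

Section CaroTuza.
Variables (R : realFieldType) (m : nat) (V I : finType) (E : I -> {set V}).
Hypothesis E_uniform : forall i, #|E i| = m.+1.

Definition hdegree (W : {set V}) (u : V) : nat :=
  #|[set i | (u \in E i) && (E i \subset W)]|.

Definition hcodegree (W : {set V}) (u v : V) : nat :=
  #|[set i | [&& v \in E i, E i \subset W & u \in E i]]|.

Lemma hdegreeD1 (W : {set V}) u v :
  hdegree W u = (hcodegree W u v + hdegree (W :\ v) u)%N.
Proof.
rewrite /hdegree /hcodegree -(cardsID [set i | v \in E i]).
congr (_ + _)%N; apply: eq_card => i; rewrite !inE.
  by rewrite andbC andbA andbAC -andbA.
by rewrite subsetD1; case: (v \in E i); rewrite /= ?andbF ?andbT.
Qed.

(** Double counting: each edge inside [W] through [v] is counted once for each of its [m] other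
    vertices. *)
Lemma sum_hcodegree (W : {set V}) v :
  (\sum_(u in W :\ v) hcodegree W u v = hdegree W v * m)%N.
Proof.
under eq_bigr => u _ do rewrite /hcodegree -sum1dep_card.
rewrite (exchange_big_dep (fun i => (v \in E i) && (E i \subset W))) /=; last first.
  by move=> u i _ /and3P[-> ->].
rewrite /hdegree -sum_nat_cond_const /=; apply: eq_big => [//|i /andP[vi iW]].
rewrite sum1dep_card; have := E_uniform i; rewrite (cardsD1 v (E i)) vi => -[<-].
rewrite add0n iW; apply: eq_card => u; rewrite !inE /=.
case: eqP => //= _; case ui: (u \in E i); rewrite ?andbF // andbT.
by rewrite (subsetP iW).
Qed.

Theorem caro_tuza (W : {set V}) :
  exists2 S : {set V}, (forall i, ~~ (E i \subset S)) &
    \sum_(u in W) ct_weight R m (hdegree W u) <= #|S|%:R.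
Proof.
have [N] := ubnP #|W|; elim: N W => // N IHN W ltWN.
have [noE|[i iW]] : (forall i, ~~ (E i \subset W)) \/ (exists i, E i \subset W).
- case: (boolP [exists i, E i \subset W]) => [/existsP|/existsPn]; by [right|left].
- exists W => //; rewrite -sum1_card natr_sum ler_sum // => u _.
  rewrite /hdegree (_ : [set _ | _] = set0) ?cards0 /ct_weight ?big_ord0 //.
  by apply/setP=> i; rewrite !inE (negPf (noE i)) andbF.
have [w wi] : exists w, w \in E i by apply/card_gt0P; rewrite E_uniform.
have wW : w \in W by apply: (subsetP iW).
have [v vW maxv] : exists2 v, v \in W & forall u, u \in W -> (hdegree W u <= hdegree W v)%N.
  by case: (arg_maxnP (hdegree W) wW) => v; exists v.
(* The maximum degree is positive because [w] lies on the edge [i]; [D] is one less than it. *)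
have [D degv] : exists D, hdegree W v = D.+1.
  exists (hdegree W v).-1; rewrite prednK // (leq_trans _ (maxv w wW)) //.
  by apply/card_gt0P; exists i; rewrite inE wi.
have [|S indS leS] := IHN (W :\ v); first by rewrite (cardsD1 v W) vW in ltWN.
exists S => //; apply: le_trans leS.
(* The weight of [v] becomes one drop at [D] per lost incidence, shared among the other vertices by
   their codegree with [v]. *)
rewrite (big_setD1 v) //= degv -ct_weight_dropM -degv -sum_hcodegree natr_sum.
rewrite mulr_suml -big_split ler_sum //= => u /setD1P[_ uW].
rewrite -lerBrDr [hdegree W u](hdegreeD1 _ _ v).
rewrite degv; apply: ct_weight_convex; rewrite -hdegreeD1 -degv; exact: maxv.
Qed.

End CaroTuza.

Lemma ct_weight_fact (R : realFieldType) (m d : nat) : (0 < m)%N ->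
  ct_weight R m d =
  (d`!)%:R / \prod_(0 <= i < d) (m.+1%:R / (m.+1%:R - 1) + i%:R).
Proof.
move=> m0; have nzm : m%:R != 0 :> R by rewrite pnatr_eq0 -lt0n.
elim: d => [|d IHd].
  by rewrite /ct_weight big_ord0 big_geq // fact0 divr1.
(* Dividing [d.+1] by this factor gives the new factor of [ct_weight]. *)
have termE : m.+1%:R / (m.+1%:R - 1) + d%:R = (m * d.+1).+1%:R / m%:R :> R.
  rewrite -[m.+1%:R]natr1 addrK -natr1 natrM -natr1.
  by move: (d%:R) => x; field.
rewrite ct_weightS IHd big_nat_recr //= termE factS !natrM invfM invf_div.
by ring.
Qed.

Theorem theorem3 (R : realFieldType) (k n : nat) (T : finType) (e : rel T)
    (k_gt1 : (1 < k)%N) (e_simple : simple_graph e) (e_regular : regular e k)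
    (e_bipartite : bipartite e) (order_n : #|T| = n) :
  (total_dom_number e)%:R <=
    n%:R * (1 - (k`!)%:R / \prod_(0 <= i < k) (k%:R / (k%:R - 1) + i%:R)) :> R.
Proof.
case: e_simple => e_sym _; case: k k_gt1 e_regular => [//|m] m_gt0 reg.
(* Edges are indexed by vertices, so vertices with equal neighbourhoods still give distinct
   edges. *)
have [S indS leS] := @caro_tuza R m T T (fun x => [set y | e x y]) reg [set: T].
have domS : total_dominating e (~: S).
  apply/forallP=> x; have /subsetPn[y] := indS x.
  by rewrite inE => exy yS; apply/exists_inP; exists y; rewrite ?inE.
have [_ /(_ _ domS) le_dom] := total_dom_numberP domS.
(* By symmetry, the neighbourhoods containing [u] are those of its neighbours. *)
have degT u : hdegree T T (fun x => [set y | e x y]) [set: T] u = m.+1.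
  by rewrite -(reg u); apply: eq_card => x; rewrite !inE subsetT andbT e_sym.
move: leS; rewrite (eq_bigr (fun=> ct_weight R m m.+1)) => [|u _]; last by rewrite degT.
rewrite sumr_const cardsT order_n ct_weight_fact // -[_ *+ n]mulr_natl => leS.
rewrite mulrBr [n%:R * 1]mulr1 lerBrDr; apply: (le_trans (y := #|~: S|%:R + #|S|%:R)).
  by rewrite lerD ?ler_nat.
by rewrite -natrD addnC cardsC order_n.
Qed.
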